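(* Every topos $\mathscr{E}$ is an adhesive category.
   Context: ''Topos'' means elementary topos. A pushout square of a span $A \xleftarrow{f} C \xrightarrow{g} B$ is called a *pushout along a monomorphism* if at least one of $f$, $g$ is a monomorphism. A category $\mathscr{C}$ with pullbacks is *adhesive* if: (1) it has pushouts along monomorphisms, i.e. every span $A \xleftarrow{f} C \xrightarrow{g} B$ in which $f$ or $g$ is a monomorphism has a pushout; (2) every pushout along a monomorphism is stable under pullback, i.e. for any such pushout square with vertex $D$ and any morphism $D' \to D$, pulling the square back along $D' \to D$ gives again a pushout square; (3) for every commutative cube with bottom face a square $C\to A$, $C\to B$, $A\to D$, $B\to D$, top face a square $C'\to A'$, $C'\to B'$, $A'\to D'$, $B'\to D'$, and vertical morphisms $A'\to A$, $B'\to B$, $C'\to C$, $D'\to D$, if the top and bottom faces are pushouts along monomorphisms and the two faces containing the vertical morphism $C'\to C$ (namely the face on $C',B',C,B$ and the face on $C',A',C,A$) are pullbacks, then the remaining two faces (on $A',D',A,D$ and on $B',D',B,D$) are pullbacks. Equivalently, (2) and (3) together say: in any such commutative cube whose bottom face is a pushout along a monomorphism and whose two faces containing $C'\to C$ are pullbacks, the top face is a pushout if and only if the two faces containing $D'\to D$ are pullbacks. *)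

(* Defs.v *)
Declare Scope cat_scope.
Delimit Scope cat_scope with cat.

Record category : Type := Category {
  Ob :> Type;
  hom : Ob -> Ob -> Type;
  idm : forall A : Ob, hom A A;
  comp : forall A B C : Ob, hom B C -> hom A B -> hom A C;
  comp_assoc : forall (A B C D : Ob) (h : hom C D) (g : hom B C) (f : hom A B),
    comp A B D (comp B C D h g) f = comp A C D h (comp A B C g f);
  comp_id_l : forall (A B : Ob) (f : hom A B), comp A B B (idm B) f = f;
  comp_id_r : forall (A B : Ob) (f : hom A B), comp A A B f (idm A) = f
}.

Arguments hom {_} _ _.
Arguments idm {_} _.
Arguments comp {_ _ _ _} _ _.

Notation "A --> B" := (hom A B)
  (at level 99, B at level 200, right associativity) : cat_scope.
Notation "g \o f" := (comp g f) (at level 50, left associativity) : cat_scope.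

Local Open Scope cat_scope.

Section UniversalProperties.
Context {E : category}.

Definition is_mono {A B : E} (m : A --> B) : Prop :=
  forall (X : E) (x y : X --> A), m \o x = m \o y -> x = y.

Definition is_terminal (T : E) : Prop :=
  forall X : E, exists! u : X --> T, True.

Definition is_product {A B P : E} (p : P --> A) (q : P --> B) : Prop :=
  forall (X : E) (x : X --> A) (y : X --> B),
    exists! h : X --> P, p \o h = x /\ q \o h = y.

(*      P --q--> B
        |        |
        p        g
        v        v
        A --f--> C      *)
Definition is_pullback {A B C P : E}
    (p : P --> A) (q : P --> B) (f : A --> C) (g : B --> C) : Prop :=
  f \o p = g \o q /\
  forall (X : E) (x : X --> A) (y : X --> B), f \o x = g \o y ->
    exists! h : X --> P, p \o h = x /\ q \o h = y.

(*      C --g--> B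
        |        |
        f        j
        v        v
        A --i--> D      *)
Definition is_pushout {A B C D : E}
    (f : C --> A) (g : C --> B) (i : A --> D) (j : B --> D) : Prop :=
  i \o f = j \o g /\
  forall (X : E) (x : A --> X) (y : B --> X), x \o f = y \o g ->
    exists! h : D --> X, h \o i = x /\ h \o j = y.

Definition is_pushout_along_mono {A B C D : E}
    (f : C --> A) (g : C --> B) (i : A --> D) (j : B --> D) : Prop :=
  is_pushout f g i j /\ (is_mono f \/ is_mono g).

(* [Q] is a product X * A and [h] below is the morphism
   lam * id_A : X * A --> BA * A. *)
Definition is_exponential {A B BA P : E}
    (p : P --> BA) (q : P --> A) (ev : P --> B) : Prop :=
  is_product p q /\
  forall (X Q : E) (s : Q --> X) (t : Q --> A), is_product s t ->
  forall f : Q --> B,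
    exists! lam : X --> BA,
      exists h : Q --> P, p \o h = lam \o s /\ q \o h = t /\ ev \o h = f.

Definition is_subobject_classifier {T Omega : E} (tr : T --> Omega) : Prop :=
  is_terminal T /\
  forall (U X : E) (m : U --> X), is_mono m ->
    exists! chi : X --> Omega, exists u : U --> T, is_pullback m u chi tr.

End UniversalProperties.

Section Completeness.
Variable E : category.

Definition has_terminal : Prop := exists T : E, is_terminal T.

Definition has_binary_products : Prop :=
  forall A B : E, exists (P : E) (p : P --> A) (q : P --> B), is_product p q.

Definition has_pullbacks : Prop :=
  forall (A B C : E) (f : A --> C) (g : B --> C),
    exists (P : E) (p : P --> A) (q : P --> B), is_pullback p q f g.

Definition has_finite_limits : Prop :=
  has_terminal /\ has_binary_products /\ has_pullbacks.

Definition has_exponentials : Prop :=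
  forall A B : E, exists (BA P : E) (p : P --> BA) (q : P --> A) (ev : P --> B),
    is_exponential p q ev.

Definition has_subobject_classifier : Prop :=
  exists (T Omega : E) (tr : T --> Omega), is_subobject_classifier tr.

Definition has_pushouts_along_monos : Prop :=
  forall (A B C : E) (f : C --> A) (g : C --> B), is_mono f \/ is_mono g ->
    exists (D : E) (i : A --> D) (j : B --> D), is_pushout f g i j.

End Completeness.

Record is_topos (E : category) : Prop := {
  topos_finite_limits : has_finite_limits E;
  topos_exponentials : has_exponentials E;
  topos_subobject_classifier : has_subobject_classifier E
}.

Section Cubes.
Context {E : category}.

(* Bottom face f, g, i, j (oriented as in [is_pushout]), top face f', g', i', j',
   vertical morphisms a, b, c, d from the top face to the bottom face. *)
Record commutative_cube {A B C D A' B' C' D' : E}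
    (f : C --> A) (g : C --> B) (i : A --> D) (j : B --> D)
    (f' : C' --> A') (g' : C' --> B') (i' : A' --> D') (j' : B' --> D')
    (a : A' --> A) (b : B' --> B) (c : C' --> C) (d : D' --> D) : Prop := {
  cube_bottom : i \o f = j \o g;
  cube_top : i' \o f' = j' \o g';
  cube_CA : a \o f' = f \o c;
  cube_CB : b \o g' = g \o c;
  cube_AD : d \o i' = i \o a;
  cube_BD : d \o j' = j \o b
}.

End Cubes.

Section Adhesive.
Variable E : category.

(* A', B', C' are the pullbacks of A, B, C along d : D' --> D; commutativity of
   the cube forces f' and g' to be the induced morphisms between them. *)
Definition pushouts_along_monos_stable : Prop :=
  forall (A B C D A' B' C' D' : E)
    (f : C --> A) (g : C --> B) (i : A --> D) (j : B --> D)
    (f' : C' --> A') (g' : C' --> B') (i' : A' --> D') (j' : B' --> D')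
    (a : A' --> A) (b : B' --> B) (c : C' --> C) (d : D' --> D),
    commutative_cube f g i j f' g' i' j' a b c d ->
    is_pushout_along_mono f g i j ->
    is_pullback a i' i d ->
    is_pullback b j' j d ->
    is_pullback c (i' \o f') (i \o f) d ->
    is_pushout f' g' i' j'.

Definition adhesive_cube_condition : Prop :=
  forall (A B C D A' B' C' D' : E)
    (f : C --> A) (g : C --> B) (i : A --> D) (j : B --> D)
    (f' : C' --> A') (g' : C' --> B') (i' : A' --> D') (j' : B' --> D')
    (a : A' --> A) (b : B' --> B) (c : C' --> C) (d : D' --> D),
    commutative_cube f g i j f' g' i' j' a b c d ->
    is_pushout_along_mono f g i j ->
    is_pushout_along_mono f' g' i' j' ->
    is_pullback c f' f a ->
    is_pullback c g' g b ->
    is_pullback a i' i d /\ is_pullback b j' j d.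

Record is_adhesive : Prop := {
  adhesive_pullbacks : has_pullbacks E;
  adhesive_pushouts : has_pushouts_along_monos E;
  adhesive_stable : pushouts_along_monos_stable;
  adhesive_cube : adhesive_cube_condition
}.

End Adhesive.

(* Main.v *)
Require Import Defs.
From Stdlib Require Setoid.

(** A morphism [Y --> X] is read as an element of [X] at stage [Y], and a
    representable predicate on such elements is a subobject of [X].  A sieve on
    [X] is called covering when, after any change of stage, it entails only
    what holds outright, as far as representable predicates can tell; this is
    the impredicative encoding of "or" and "exists", so covers may be used to
    argue by cases.  For [f] mono, a commutative square is a pushout iff [j] is
    mono, [i a = j b] forces [a] and [b] to come from one [c], [i a = i a']
    locally forces [a = a'] or [a = f c], [a' = f c'] with [g c = g c'], and
    every [d] is locally [i a] or [j b].  The pushout is found inside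
    [PA * PB], an element being sent to its fibres over [A] and [B].  These
    elementwise conditions make stability and the cube condition a matter of
    case analysis. *)

Local Open Scope cat_scope.

(** * Universal properties in elementwise form *)

Section UniversalPropertyFacts.
Context {E : category}.

Lemma product_pair {A B P : E} {p : P --> A} {q : P --> B} (hP : is_product p q)
    {X : E} (x : X --> A) (y : X --> B) :
  exists h : X --> P, p \o h = x /\ q \o h = y.
Proof. destruct (hP X x y) as [h [hh _]]; now exists h. Qed.

Lemma product_ext {A B P : E} {p : P --> A} {q : P --> B} (hP : is_product p q)
    {X : E} (h k : X --> P) : p \o h = p \o k -> q \o h = q \o k -> h = k.
Proof.
  intros e1 e2; destruct (hP X (p \o h) (q \o h)) as [l [_ u]].
  transitivity l; [symmetry|]; apply u; split; congruence.
Qed.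

Lemma pullback_lift {A B C P : E} {p : P --> A} {q : P --> B} {f : A --> C} {g : B --> C}
    (hP : is_pullback p q f g) {X : E} (x : X --> A) (y : X --> B) :
  f \o x = g \o y -> exists h : X --> P, p \o h = x /\ q \o h = y.
Proof. intros e; destruct (proj2 hP X x y e) as [h [hh _]]; now exists h. Qed.

Lemma pullback_ext {A B C P : E} {p : P --> A} {q : P --> B} {f : A --> C} {g : B --> C}
    (hP : is_pullback p q f g) {X : E} (h k : X --> P) :
  p \o h = p \o k -> q \o h = q \o k -> h = k.
Proof.
  intros e1 e2; destruct hP as [e hP].
  destruct (hP X (p \o h) (q \o h)) as [l [_ u]].
  { now rewrite <- !comp_assoc, e. }
  transitivity l; [symmetry|]; apply u; split; congruence.
Qed.

Lemma is_pullback_intro {A B C P : E} {p : P --> A} {q : P --> B} {f : A --> C} {g : B --> C} :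
  f \o p = g \o q ->
  (forall X (x : X --> A) (y : X --> B), f \o x = g \o y ->
     exists h : X --> P, p \o h = x /\ q \o h = y) ->
  (forall X (h k : X --> P), p \o h = p \o k -> q \o h = q \o k -> h = k) ->
  is_pullback p q f g.
Proof.
  intros e ex un; split; [exact e|].
  intros X x y exy; destruct (ex X x y exy) as [h [h1 h2]].
  exists h; split; [now split|].
  intros k [k1 k2]; apply un; congruence.
Qed.

Lemma mono_pullback {A B C P : E} {p : P --> A} {q : P --> B} {f : A --> C} {g : B --> C} :
  is_pullback p q f g -> is_mono f -> is_mono q.
Proof.
  intros hP mf X x y e; apply (pullback_ext hP); [|exact e].
  apply mf; rewrite <- !comp_assoc, (proj1 hP), !comp_assoc; congruence.
Qed.

Lemma pushout_sym {A B C D : E} {f : C --> A} {g : C --> B} {i : A --> D} {j : B --> D} :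
  is_pushout f g i j -> is_pushout g f j i.
Proof.
  intros [e u]; split; [easy|].
  intros X x y exy; destruct (u X y x (eq_sym exy)) as [h [[h1 h2] un]].
  exists h; split; [easy|]; intros k [k1 k2]; apply un; easy.
Qed.

Lemma pushout_iso {A B C D D' : E} {f : C --> A} {g : C --> B}
    {i : A --> D} {j : B --> D} {i' : A --> D'} {j' : B --> D'} :
  is_pushout f g i j -> is_pushout f g i' j' ->
  exists (h : D --> D') (k : D' --> D),
    h \o k = idm D' /\ k \o i' = i /\ k \o j' = j /\ h \o i = i' /\ h \o j = j'.
Proof.
  intros [e u] [e' u'].
  destruct (u _ i' j' e') as [h [[h1 h2] _]].
  destruct (u' _ i j e) as [k [[k1 k2] _]].
  exists h, k; repeat split; try assumption.
  destruct (u' _ i' j' e') as [l [_ un]].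
  transitivity l; [symmetry|]; apply un; rewrite ?comp_assoc, ?comp_id_l; split; congruence.
Qed.

End UniversalPropertyFacts.

(** * Representable predicates and covering sieves *)

Section Representable.
Context {E : category}.

Definition factors {X Y U : E} (m : U --> X) (y : Y --> X) : Prop :=
  exists u : Y --> U, m \o u = y.

Definition representable {X : E} (phi : forall Y : E, (Y --> X) -> Prop) : Prop :=
  exists (U : E) (m : U --> X), is_mono m /\ forall Y y, phi Y y <-> factors m y.

(** All product cones are quantified over, since products are only known to exist and none is
    fixed. *)
Definition representable2 {X A : E}
    (phi : forall Y : E, (Y --> X) -> (Y --> A) -> Prop) : Prop :=
  forall (P : E) (p : P --> X) (q : P --> A), is_product p q ->
    representable (fun Y h => phi Y (p \o h) (q \o h)).

(** [phi Z (idm Z)] says that the subobject of [Z] is everything; the quantifier over [z] builds in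
    stability under change of stage. *)
Definition covering {X : E} (S : forall Y : E, (Y --> X) -> Prop) : Prop :=
  forall (Z : E) (z : Z --> X) (phi : forall Y : E, (Y --> Z) -> Prop),
    representable phi ->
    (forall T (t : T --> Z), S T (z \o t) -> phi T t) -> phi Z (idm Z).

Lemma rep_ext {X : E} {phi psi : forall Y : E, (Y --> X) -> Prop} :
  representable phi -> (forall Y y, phi Y y <-> psi Y y) -> representable psi.
Proof.
  intros (U & m & mm & hm) e; exists U, m; split; [exact mm|].
  intros Y y; now rewrite <- e.
Qed.

Lemma rep_mono {X U : E} (m : U --> X) :
  is_mono m -> representable (fun Y y => factors m y).
Proof. intros mm; now exists U, m. Qed.

Lemma covering_weaken {X : E} {S S' : forall Y : E, (Y --> X) -> Prop} :
  covering S -> (forall T t, S T t -> S' T t) -> covering S'.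
Proof. intros c w Z z phi r h; apply (c Z z phi r); auto. Qed.

Lemma covering_all {X : E} {S : forall Y : E, (Y --> X) -> Prop} :
  (forall T t, S T t) -> covering S.
Proof. intros s Z z phi r h; auto. Qed.

Lemma covering_pull {X Y : E} {S : forall Y : E, (Y --> X) -> Prop} (y : Y --> X) :
  covering S -> covering (fun T t => S T (y \o t)).
Proof.
  intros c Z z phi r h; apply (c Z (y \o z) phi r).
  intros T t; rewrite comp_assoc; apply h.
Qed.

Lemma covering_elim {X : E} {S : forall Y : E, (Y --> X) -> Prop}
    {phi : forall Y : E, (Y --> X) -> Prop} :
  covering S -> representable phi -> (forall T t, S T t -> phi T t) -> phi X (idm X).
Proof. intros c r h; apply (c X (idm X) phi r); intros T t; rewrite comp_id_l; apply h. Qed.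

Hypothesis hpb : has_pullbacks E.
Hypothesis hprod : has_binary_products E.

Lemma rep_subst {X X' : E} (f : X' --> X) {phi : forall Y : E, (Y --> X) -> Prop} :
  representable phi -> representable (fun Y y => phi Y (f \o y)).
Proof.
  intros (U & m & mm & hm).
  destruct (hpb _ _ _ m f) as (P & p & q & hP).
  exists P, q; split; [exact (mono_pullback hP mm)|].
  intros Y y; rewrite hm; split.
  - intros [u hu]; destruct (pullback_lift hP u y hu) as (h & _ & hh); now exists h.
  - intros [u hu]; exists (p \o u).
    now rewrite <- hu, <- comp_assoc, (proj1 hP), comp_assoc.
Qed.

(** The representing subobject is the equalizer, built as the pullback of the graphs of [f] and
    [g]. *)
Lemma rep_eq {X C : E} (f g : X --> C) : representable (fun Y y => f \o y = g \o y).
Proof.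
  destruct (hprod X C) as (Q & p & q & hQ).
  destruct (product_pair hQ (idm X) f) as (u & u1 & u2).
  destruct (product_pair hQ (idm X) g) as (v & v1 & v2).
  destruct (hpb _ _ _ u v) as (P & r & s & hP).
  (* Both graphs have the identity as first component, so the two legs of the pullback agree. *)
  assert (rs : r = s).
  { generalize (f_equal (fun h => p \o h) (proj1 hP)).
    now rewrite <- !comp_assoc, u1, v1, !comp_id_l. }
  exists P, r; split.
  - intros Y x y e; apply (pullback_ext hP); congruence.
  - intros Y y; split.
    + intros e; destruct (pullback_lift hP y y) as (h & h1 & _).
      * apply (product_ext hQ); rewrite <- !comp_assoc; congruence.
      * now exists h.
    + intros [w <-]; rewrite <- u2, <- v2, !comp_assoc; f_equal.
      rewrite <- !comp_assoc; f_equal; rewrite (proj1 hP); congruence.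
Qed.

Lemma rep_and {X : E} {phi psi : forall Y : E, (Y --> X) -> Prop} :
  representable phi -> representable psi ->
  representable (fun Y y => phi Y y /\ psi Y y).
Proof.
  intros (U & m & mm & hm) hpsi.
  destruct (rep_subst m hpsi) as (V & n & mn & hn).
  exists V, (m \o n); split.
  - intros Y x y; rewrite !comp_assoc; intros e; now apply mn, mm.
  - intros Y y; rewrite hm; split.
    + intros [[u <-] h]; apply hn in h as [v <-]; exists v; now rewrite comp_assoc.
    + intros [v <-]; split.
      * exists (n \o v); now rewrite comp_assoc.
      * rewrite comp_assoc; apply hn; now exists v.
Qed.

(** Equality is a representable predicate, so it can be tested on a cover: covers are jointly
    epic. *)
Lemma covering_eq {X C : E} {S : forall Y : E, (Y --> X) -> Prop} {f g : X --> C} :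
  covering S -> (forall T (t : T --> X), S T t -> f \o t = g \o t) -> f = g.
Proof.
  intros c h; rewrite <- (comp_id_r _ _ _ f), <- (comp_id_r _ _ _ g).
  exact (covering_elim c (rep_eq f g) h).
Qed.

(** Transitivity of covers: the restriction of [phi] along a member [t] of [S] is still
    representable, so the cover given over [t] eliminates into it. *)
Lemma covering_bind {X : E} {S S' : forall Y : E, (Y --> X) -> Prop} :
  covering S ->
  (forall T (t : T --> X), S T t -> covering (fun V v => S' V (t \o v))) ->
  covering S'.
Proof.
  intros c b Z z phi r h; apply (c Z z phi r).
  intros T t st; rewrite <- (comp_id_r _ _ _ t).
  apply (covering_elim (b T (z \o t) st) (rep_subst t r)).
  intros V v; rewrite comp_assoc; apply h.
Qed.

(* Local existence plus uniqueness is global existence: the domain of definition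
   of a representable functional relation is again a subobject. *)
Lemma unique_choice {X V : E} {phi : forall Y : E, (Y --> X) -> (Y --> V) -> Prop} :
  representable2 phi ->
  covering (fun T t => exists v, phi T t v) ->
  (forall T t v v', phi T t v -> phi T t v' -> v = v') ->
  exists v, phi X (idm X) v.
Proof.
  intros r c un.
  destruct (hprod X V) as (P & p & q & hP).
  destruct (r P p q hP) as (U & m & mm & hm).
  (* Uniqueness of values makes the projection from the graph [U] to [X] mono; the cover then yields
     a section [u] of it. *)
  assert (mpm : is_mono (p \o m)).
  { intros Y x y e; rewrite !comp_assoc in e.
    apply mm, (product_ext hP); [exact e|].
    apply (un Y (p \o (m \o x))).
    - apply hm; now exists x.
    - rewrite e; apply hm; now exists y. }
  destruct (covering_elim c (rep_mono _ mpm)) as [u hu].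
  - intros T t [v hv].
    destruct (product_pair hP t v) as (h & h1 & h2).
    assert (hh : factors m h) by (apply hm; now rewrite h1, h2).
    destruct hh as [u hu]; exists u; rewrite comp_assoc; congruence.
  - exists (q \o (m \o u)).
    rewrite <- hu, comp_assoc; apply hm; now exists u.
Qed.

End Representable.

(** * Gluing squares under isomorphism, under pullback and in cubes *)

Section Gluing.
Context {E : category}.

(* For [f] mono, an elementwise characterization of pushout squares. *)
Record gluing {A B C D : E}
    (f : C --> A) (g : C --> B) (i : A --> D) (j : B --> D) : Prop := {
  gluing_comm : i \o f = j \o g;
  gluing_mono : is_mono j;
  gluing_meet : forall Y (a : Y --> A) (b : Y --> B), i \o a = j \o b ->
    exists c, f \o c = a /\ g \o c = b;
  gluing_ker : forall Y (a a' : Y --> A), i \o a = i \o a' ->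
    covering (fun T (t : T --> Y) => a \o t = a' \o t \/
      exists c c', f \o c = a \o t /\ f \o c' = a' \o t /\ g \o c = g \o c');
  gluing_cover : covering (fun T (t : T --> D) => factors i t \/ factors j t)
}.

(** Two pushouts of one span are isomorphic, so the conditions pass from a constructed pushout to
    any given one. *)
Lemma gluing_of_pushouts {A B C D D' : E} {f : C --> A} {g : C --> B}
    {i : A --> D} {j : B --> D} {i' : A --> D'} {j' : B --> D'} :
  is_pushout f g i j -> is_pushout f g i' j' -> gluing f g i j -> gluing f g i' j'.
Proof.
  intros po po' G.
  destruct (pushout_iso po po') as (h & k & hk & ki & kj & hi & hj).
  split.
  - apply (proj1 po').
  - intros Y x y e; apply (gluing_mono _ _ _ _ G).
    rewrite <- kj, !comp_assoc; congruence.
  - intros Y a b e; apply (gluing_meet _ _ _ _ G).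
    rewrite <- ki, <- kj, !comp_assoc; congruence.
  - intros Y a a' e; apply (gluing_ker _ _ _ _ G).
    rewrite <- ki, !comp_assoc; congruence.
  - apply (covering_weaken (covering_pull k (gluing_cover _ _ _ _ G))).
    intros T t [[a e]|[b e]]; [left; exists a|right; exists b];
      rewrite <- ?hi, <- ?hj, comp_assoc, e, <- comp_assoc, hk; apply comp_id_l.
Qed.

(** An element of [A'], [B'] or [C'] is an element of [A], [B] or [C] together with one of [D'] over
    the same element of [D]. Each condition is applied below and its result lifted, carrying the
    component in [D'] along. *)
Lemma gluing_pullback {A B C D A' B' C' D' : E}
    {f : C --> A} {g : C --> B} {i : A --> D} {j : B --> D}
    {f' : C' --> A'} {g' : C' --> B'} {i' : A' --> D'} {j' : B' --> D'}
    {a : A' --> A} {b : B' --> B} {c : C' --> C} {d : D' --> D} :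
  commutative_cube f g i j f' g' i' j' a b c d ->
  gluing f g i j ->
  is_pullback a i' i d -> is_pullback b j' j d -> is_pullback c (i' \o f') (i \o f) d ->
  gluing f' g' i' j'.
Proof.
  intros [eb et eCA eCB eAD eBD] G hA hB hC.
  (* The last clause recognizes [f' \o z] by its components in [A] and [D']; [gext] does the same
     for [g' \o z]. *)
  assert (liftC : forall Y (x : Y --> C) (y : Y --> D'), i \o (f \o x) = d \o y ->
    exists z, c \o z = x /\ i' \o (f' \o z) = y /\
      forall w, a \o w = f \o x -> i' \o w = y -> f' \o z = w).
  { intros Y x y e; rewrite <- comp_assoc in e.
    destruct (pullback_lift hC x y e) as (z & z1 & z2); rewrite comp_assoc in z2.
    exists z; repeat split; [exact z1|exact z2|].
    intros w w1 w2; apply (pullback_ext hA); [|congruence].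
    rewrite <- comp_assoc, eCA, comp_assoc; congruence. }
  assert (gext : forall Y (z : Y --> C') w, b \o w = g \o (c \o z) ->
    j' \o w = i' \o (f' \o z) -> g' \o z = w).
  { intros Y z w w1 w2; apply (pullback_ext hB).
    - now rewrite <- comp_assoc, eCB, comp_assoc.
    - now rewrite w2, <- !comp_assoc, et. }
  split.
  - exact et.
  - intros Y x y e; apply (pullback_ext hB); [|exact e].
    apply (gluing_mono _ _ _ _ G).
    rewrite <- !comp_assoc, <- eBD, !comp_assoc; congruence.
  - intros Y x y e.
    destruct (gluing_meet _ _ _ _ G Y (a \o x) (b \o y)) as (z & z1 & z2).
    { rewrite <- !comp_assoc, <- eAD, <- eBD, !comp_assoc; congruence. }
    destruct (liftC Y z (i' \o x)) as (w & w1 & w2 & w3).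
    { now rewrite z1, <- !comp_assoc, eAD. }
    exists w; split.
    + now apply w3.
    + apply gext; congruence.
  - intros Y x x' e.
    assert (e' : i \o (a \o x) = i \o (a \o x')).
    { rewrite <- !comp_assoc, <- eAD, !comp_assoc; congruence. }
    apply (covering_weaken (gluing_ker _ _ _ _ G Y _ _ e')).
    intros T t; rewrite !comp_assoc.
    assert (et' : i' \o (x \o t) = i' \o (x' \o t)) by (rewrite <- !comp_assoc; congruence).
    intros [h|(z & z' & h & h' & hg)].
    + left; now apply (pullback_ext hA).
    + right.
      destruct (liftC T z (i' \o (x \o t))) as (w & w1 & w2 & w3).
      { now rewrite h, <- !comp_assoc, eAD. }
      destruct (liftC T z' (i' \o (x' \o t))) as (w' & w1' & w2' & w3').
      { now rewrite h', <- !comp_assoc, eAD. }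
      exists w, w'; repeat split; [now apply w3|now apply w3'|].
      apply gext.
      * rewrite <- comp_assoc, eCB, comp_assoc; congruence.
      * rewrite <- comp_assoc, <- et, comp_assoc; congruence.
  - apply (covering_weaken (covering_pull d (gluing_cover _ _ _ _ G))).
    intros T t [[x e]|[y e]].
    + left; destruct (pullback_lift hA x t e) as (z & _ & hz); now exists z.
    + right; destruct (pullback_lift hB y t e) as (z & _ & hz); now exists z.
Qed.

Hypothesis hpb : has_pullbacks E.
Hypothesis hprod : has_binary_products E.

(** Lifts into [A'] and [B'] are unique, so by [unique_choice] it is enough to find them on a cover
    of [D']. *)
Lemma gluing_cube {A B C D A' B' C' D' : E}
    {f : C --> A} {g : C --> B} {i : A --> D} {j : B --> D}
    {f' : C' --> A'} {g' : C' --> B'} {i' : A' --> D'} {j' : B' --> D'}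
    {a : A' --> A} {b : B' --> B} {c : C' --> C} {d : D' --> D} :
  commutative_cube f g i j f' g' i' j' a b c d ->
  is_mono f -> gluing f g i j -> gluing f' g' i' j' ->
  is_pullback c f' f a -> is_pullback c g' g b ->
  is_pullback a i' i d /\ is_pullback b j' j d.
Proof.
  intros [eb et eCA eCB eAD eBD] mf G G' hA hB.
  assert (et' : forall Y (z : Y --> C'), i' \o (f' \o z) = j' \o (g' \o z))
    by (intros; rewrite <- !comp_assoc; congruence).
  (* In the second case of [gluing_ker], [f] mono gives [c \o z = c \o z'], and the pullback over
     [B] then forces [z = z']. *)
  assert (un : forall T (h k : T --> A'), a \o h = a \o k -> i' \o h = i' \o k -> h = k).
  { intros T h k e1 e2.
    apply (covering_eq hpb hprod (gluing_ker _ _ _ _ G' T h k e2)).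
    intros V v [e3|(z & z' & h1 & h2 & h3)]; [exact e3|].
    rewrite <- h1, <- h2; f_equal; apply (pullback_ext hB); [|exact h3].
    apply mf; rewrite <- !comp_assoc, <- eCA, !comp_assoc, h1, h2, <- !comp_assoc; congruence. }
  split; apply is_pullback_intro; try easy.
  - intros X x y e.
    assert (ex : exists h, a \o h = x \o idm X /\ i' \o h = y \o idm X).
    { apply (unique_choice hprod (phi := fun T t h => a \o h = x \o t /\ i' \o h = y \o t)).
      - intros P p q hP; apply (rep_and hpb).
        + apply (rep_ext (rep_eq hpb hprod (a \o q) (x \o p))); intros Y w; now rewrite !comp_assoc.
        + apply (rep_ext (rep_eq hpb hprod (i' \o q) (y \o p))); intros Y w; now rewrite !comp_assoc.
      (* On the part of [D'] coming from [A'], the lift exists only after the further cover supplied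
         by [gluing_ker]. *)
      - apply (covering_bind hpb (covering_pull y (gluing_cover _ _ _ _ G'))).
        intros T t [[u hu]|[v hv]].
        + assert (e' : i \o (a \o u) = i \o (x \o t)).
          { rewrite <- !comp_assoc, <- eAD, !comp_assoc, hu, <- !comp_assoc; congruence. }
          apply (covering_weaken (gluing_ker _ _ _ _ G _ _ _ e')).
          intros V v [h|(z & z' & h1 & h2 & h3)].
          * exists (u \o v); rewrite <- !comp_assoc, h, hu, comp_assoc; split; [reflexivity|].
            now rewrite comp_assoc.
          (* The lift [u] lies over [f z] instead of [f z']. It is corrected through [C']: [w] lies
             over [z] with [f' w = u], and [w'] lies over [z'] with the same image in [B'], so
             [f' w'] has the same image in [D'] as [u]. *)
          * destruct (pullback_lift hA z (u \o v)) as (w & w1 & w2).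
            { now rewrite h1, comp_assoc. }
            destruct (pullback_lift hB z' (g' \o w)) as (w' & w1' & w2').
            { rewrite <- h3, <- w1, <- !comp_assoc; congruence. }
            exists (f' \o w'); split.
            -- rewrite <- !comp_assoc, eCA, comp_assoc, w1', h2; reflexivity.
            -- rewrite et', w2', <- et', w2, <- !comp_assoc, hu; reflexivity.
        + destruct (gluing_meet _ _ _ _ G T (x \o t) (b \o v)) as (z & z1 & z2).
          { rewrite <- !comp_assoc, <- eBD, !comp_assoc, hv, <- !comp_assoc; congruence. }
          destruct (pullback_lift hB z v z2) as (w & w1 & w2).
          apply covering_all; intros V v'; exists (f' \o w \o v'); split.
          * rewrite <- !comp_assoc, eCA, (comp_assoc _ _ _ _ _ _ c), w1, z1; reflexivity.
          * rewrite <- !comp_assoc, (comp_assoc _ _ _ _ _ _ f'), et', w2, hv; reflexivity.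
      - intros T t v v' [h1 h2] [h3 h4]; apply un; congruence. }
    destruct ex as (h & h1 & h2); rewrite comp_id_r in h1, h2; now exists h.
  (* For [B] each piece has a lift at once: [gluing_meet] handles the one from [A'], [gluing_mono]
     the one from [B']. *)
  - intros X x y e.
    assert (ex : exists h, b \o h = x \o idm X /\ j' \o h = y \o idm X).
    { apply (unique_choice hprod (phi := fun T t h => b \o h = x \o t /\ j' \o h = y \o t)).
      - intros P p q hP; apply (rep_and hpb).
        + apply (rep_ext (rep_eq hpb hprod (b \o q) (x \o p))); intros Y w; now rewrite !comp_assoc.
        + apply (rep_ext (rep_eq hpb hprod (j' \o q) (y \o p))); intros Y w; now rewrite !comp_assoc.
      - apply (covering_weaken (covering_pull y (gluing_cover _ _ _ _ G'))).
        intros T t [[u hu]|[v hv]].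
        + destruct (gluing_meet _ _ _ _ G T (a \o u) (x \o t)) as (z & z1 & z2).
          { rewrite <- !comp_assoc, <- eAD, !comp_assoc, hu, <- !comp_assoc; congruence. }
          destruct (pullback_lift hA z u z1) as (w & w1 & w2).
          exists (g' \o w); split.
          * rewrite <- comp_assoc, eCB, comp_assoc; congruence.
          * rewrite <- et'; congruence.
        + exists v; split; [|exact hv].
          apply (gluing_mono _ _ _ _ G).
          rewrite <- !comp_assoc, <- eBD, !comp_assoc, hv, <- !comp_assoc; congruence.
      - intros T t v v' [_ h2] [_ h4]; apply (gluing_mono _ _ _ _ G'); congruence. }
    destruct ex as (h & h1 & h2); rewrite comp_id_r in h1, h2; now exists h.
  - intros T h k _; apply (gluing_mono _ _ _ _ G').
Qed.

End Gluing.

(** * Higher-order logic of a topos and the construction of pushouts *)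

Section Topos.
Context {E : category}.
Hypothesis hE : is_topos E.

Local Lemma hpb : has_pullbacks E.
Proof. apply (topos_finite_limits E hE). Qed.

Local Lemma hprod : has_binary_products E.
Proof. apply (topos_finite_limits E hE). Qed.

(** Existence and uniqueness of classifying morphisms become comprehension and extensionality, with
    [holds] meaning factorization through [tr]. *)
Lemma truth_values :
  exists (Omega : E) (holds : forall Y, (Y --> Omega) -> Prop),
    representable holds /\
    (forall (X : E) (phi : forall Y, (Y --> X) -> Prop), representable phi ->
       exists chi : X --> Omega, forall Y y, holds Y (chi \o y) <-> phi Y y) /\
    (forall (X : E) (w w' : X --> Omega),
       (forall Y (y : Y --> X), holds Y (w \o y) <-> holds Y (w' \o y)) -> w = w').
Proof.
  destruct (topos_subobject_classifier E hE) as (T & Omega & tr & hT & cl).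
  assert (mtr : is_mono tr).
  { intros X x y _; destruct (hT X) as (u & _ & un).
    transitivity u; [symmetry|]; now apply un. }
  exists Omega, (fun Y y => factors tr y); repeat split.
  - now apply rep_mono.
  - intros X phi (U & m & mm & hm).
    destruct (cl U X m mm) as (chi & (u & hP) & _).
    exists chi; intros Y y; rewrite hm; split.
    + intros [t ht]; destruct (pullback_lift hP y t (eq_sym ht)) as (h & hh & _); now exists h.
    + intros [v <-]; exists (u \o v).
      now rewrite <- !comp_assoc, (proj1 hP).
  - intros X w w' h.
    (* [U] is the subobject classified by [w]; the aim is that [w'] classifies it too. *)
    destruct (hpb _ _ _ tr w) as (U & u & m & hP).
    pose proof (mono_pullback hP mtr) as mm.
    destruct (cl U X m mm) as (chi & _ & un).
    transitivity chi; [symmetry|]; apply un.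
    + exists u; apply is_pullback_intro.
      * symmetry; apply hP.
      * intros Y x y e.
        destruct (pullback_lift hP y x (eq_sym e)) as (k & k1 & k2); now exists k.
      * intros Y k l e1 e2; now apply mm.
    + assert (hu : factors tr (w' \o m)).
      { apply h; exists u; apply hP. }
      destruct hu as [u' hu']; exists u'; apply is_pullback_intro.
      * easy.
      * intros Y x y e.
        assert (hx : factors tr (w \o x)) by (apply h; now exists y).
        destruct hx as [v hv].
        destruct (pullback_lift hP v x hv) as (k & _ & k2).
        exists k; split; [exact k2|].
        apply mtr; rewrite <- comp_assoc, hu', comp_assoc, k2; exact e.
      * intros Y k l e1 e2; now apply mm.
Qed.

(** [PA] is the exponential of [Omega] by [A], and [mem] is evaluation. Existence of transposes
    gives comprehension, their uniqueness extensionality. *)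
Lemma power_object (A : E) :
  exists (PA : E) (mem : forall Y, (Y --> PA) -> (Y --> A) -> Prop),
    (forall (X : E) (phi : forall Y, (Y --> X) -> (Y --> A) -> Prop), representable2 phi ->
       exists S : X --> PA, forall Y y a, mem Y (S \o y) a <-> phi Y y a) /\
    (forall (X : E) (S S' : X --> PA),
       (forall Y (y : Y --> X) a, mem Y (S \o y) a <-> mem Y (S' \o y) a) -> S = S').
Proof.
  destruct truth_values as (Omega & holds & hrep & hcl & hext).
  destruct (topos_exponentials E hE A Omega) as (PA & P & p & q & ev & hP & hlam).
  exists PA, (fun Y s a => exists h : Y --> P, p \o h = s /\ q \o h = a /\ holds Y (ev \o h)).
  split.
  - intros X phi r.
    destruct (hprod X A) as (Q & s & t & hQ).
    destruct (hcl _ _ (r Q s t hQ)) as (chi & hchi).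
    destruct (hlam X Q s t hQ chi) as (S & (h & h1 & h2 & h3) & _).
    exists S; intros Y y a.
    destruct (product_pair hQ y a) as (k & <- & <-).
    rewrite <- hchi, <- h3; split.
    + intros (l & l1 & l2 & l3); rewrite comp_assoc.
      replace (h \o k) with l; [exact l3|].
      apply (product_ext hP); rewrite <- comp_assoc; [rewrite h1, comp_assoc|]; congruence.
    + intros l; exists (h \o k); rewrite <- !comp_assoc, h1, h2; easy.
  - intros X S S' e.
    destruct (hprod X A) as (Q & s & t & hQ).
    destruct (product_pair hP (S \o s) t) as (h & h1 & h2).
    destruct (product_pair hP (S' \o s) t) as (h' & h1' & h2').
    (* One inclusion, stated for arbitrary [R] and [R'] so that it serves in both directions. *)
    assert (aux : forall (R R' : X --> PA) (k k' : Q --> P),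
      (forall Y (y : Y --> X) a,
        (exists h, p \o h = R \o y /\ q \o h = a /\ holds Y (ev \o h)) ->
        (exists h, p \o h = R' \o y /\ q \o h = a /\ holds Y (ev \o h))) ->
      p \o k = R \o s -> q \o k = t -> p \o k' = R' \o s -> q \o k' = t ->
      forall Y (y : Y --> Q), holds Y (ev \o k \o y) -> holds Y (ev \o k' \o y)).
    { intros R R' k k' i k1 k2 k1' k2' Y y hy.
      destruct (i Y (s \o y) (t \o y)) as (l & l1 & l2 & l3).
      - exists (k \o y); rewrite <- !comp_assoc, k1, k2; easy.
      - rewrite comp_assoc; replace (k' \o y) with l; [exact l3|].
        apply (product_ext hP); rewrite <- comp_assoc; [rewrite k1', comp_assoc|]; congruence. }
    assert (eev : ev \o h = ev \o h').
    { apply hext; intros Y y; split.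
      - apply (aux S S'); auto; intros; now apply e.
      - apply (aux S' S); auto; intros; now apply e. }
    destruct (hlam X Q s t hQ (ev \o h)) as (l & _ & un).
    transitivity l; [symmetry|]; apply un; [exists h|exists h']; easy.
Qed.

(** [phi] entails [psi] exactly when [phi] and its conjunction with [psi] define the same subset of
    [A]; the implication thus becomes an equation between morphisms into [PA]. *)
Lemma rep_forall_imp {X A : E} {phi psi : forall Y : E, (Y --> X) -> (Y --> A) -> Prop} :
  representable2 phi -> representable2 psi ->
  representable (fun Y (y : Y --> X) => forall Z (z : Z --> Y) (a : Z --> A),
    phi Z (y \o z) a -> psi Z (y \o z) a).
Proof.
  intros r r'.
  destruct (power_object A) as (PA & mem & hcomp & hext).
  destruct (hcomp X phi r) as (S & hS).
  destruct (hcomp X (fun Y y a => phi Y y a /\ psi Y y a)) as (S' & hS').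
  { intros P p q hP; apply (rep_and hpb); auto. }
  apply (rep_ext (rep_eq hpb hprod S S')); intros Y y; split.
  - intros e Z z a h; apply hS in h; rewrite <- comp_assoc, e, comp_assoc in h.
    now apply hS' in h.
  - intros h; apply hext; intros Z z a; rewrite !comp_assoc, hS, hS'.
    split; [|tauto]; intros h'; split; [exact h'|now apply h].
Qed.

(* "Some [T] with [alpha a = t] or [beta b = t]" is encoded as
   [forall w : Omega, (forall a, alpha a = y -> w) /\ (forall b, beta b = y -> w) -> w]. *)
Lemma rep_joint_image {A B Q : E} (alpha : A --> Q) (beta : B --> Q) :
  representable (fun Y (y : Y --> Q) =>
    covering (fun T (t : T --> Y) => factors alpha (y \o t) \/ factors beta (y \o t))).
Proof.
  destruct truth_values as (Omega & holds & hrep & hcl & hext).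
  (* One conjunct of the encoding, as a predicate on the pair of [y] and the truth value [w], with
     [P] to become the product of [Q] and [Omega]. *)
  assert (inner : forall (A : E) (alpha : A --> Q) P (p : P --> Q) (q : P --> Omega),
    representable (fun Y (y : Y --> P) => forall Z (z : Z --> Y) (a : Z --> A),
      alpha \o a = p \o (y \o z) -> holds Z (q \o (y \o z)))).
  { intros A' al P p q.
    apply (rep_forall_imp (phi := fun Y y a => al \o a = p \o y)
                          (psi := fun Y y _ => holds Y (q \o y))).
    - intros R r s hR.
      apply (rep_ext (rep_eq hpb hprod (al \o s) (p \o r))); intros; now rewrite !comp_assoc.
    - intros R r s hR; apply (rep_subst hpb r (phi := fun Y y => holds Y (q \o y))), (rep_subst hpb q), hrep. }
  eapply rep_ext.
  - apply (rep_forall_imp (A := Omega)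
      (phi := fun Y y w =>
        (forall Z (z : Z --> Y) (a : Z --> A), alpha \o a = y \o z -> holds Z (w \o z)) /\
        (forall Z (z : Z --> Y) (b : Z --> B), beta \o b = y \o z -> holds Z (w \o z)))
      (psi := fun Y _ w => holds Y w)).
    + intros P p q hP; apply (rep_and hpb);
        [apply (rep_ext (inner A alpha P p q))|apply (rep_ext (inner B beta P p q))];
        intros Y y; split; intros h Z z a; specialize (h Z z a);
        rewrite !comp_assoc in *; exact h.
    + intros P p q hP; apply (rep_subst hpb q), hrep.
  (* Morphisms [Z --> Omega] and representable predicates on [Z] are interchangeable, which matches
     the quantifier over [w] with the one inside [covering]. *)
  - intros Y y; split.
    + intros h Z z psi r hpsi.
      destruct (hcl Z psi r) as (w & hw).
      apply hw; rewrite comp_id_r; apply (h Z z w).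
      split; intros T t a e; apply hw, hpsi; [left|right]; exists a;
        rewrite <- comp_assoc; exact e.
    + intros c Z z w [hA hB].
      rewrite <- (comp_id_r _ _ _ w).
      apply (c Z z (fun T t => holds T (w \o t))); [apply (rep_subst hpb w), hrep|].
      intros T t [[a e]|[b e]]; [apply (hA T t a)|apply (hB T t b)]; now rewrite comp_assoc.
Qed.

(** The induced morphism is obtained from its graph by [unique_choice]: [gluing_cover] gives local
    values and their uniqueness, the other conditions their consistency. *)
Lemma pushout_of_gluing {A B C D : E}
    {f : C --> A} {g : C --> B} {i : A --> D} {j : B --> D} :
  gluing f g i j -> is_pushout f g i j.
Proof.
  intros G; split; [apply G|].
  intros X x y e.
  (* The graph is phrased with implications over all preimages of [d], so that [rep_forall_imp]
     makes it representable. *)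
  set (phi := fun Y (d : Y --> D) (v : Y --> X) =>
    (forall Z (z : Z --> Y) (a : Z --> A), i \o a = d \o z -> x \o a = v \o z) /\
    (forall Z (z : Z --> Y) (b : Z --> B), j \o b = d \o z -> y \o b = v \o z)).
  assert (rimp : forall (A : E) (i : A --> D) (x : A --> X) P (p : P --> D) (q : P --> X),
    representable (fun Y (h : Y --> P) => forall Z (z : Z --> Y) (a : Z --> A),
      i \o a = p \o h \o z -> x \o a = q \o h \o z)).
  { intros A' i' x' P p q.
    eapply rep_ext.
    - apply (rep_forall_imp (phi := fun Y h a => i' \o a = p \o h)
                            (psi := fun Y h a => x' \o a = q \o h)).
      + intros R r s hR.
        apply (rep_ext (rep_eq hpb hprod (i' \o s) (p \o r))); intros; now rewrite !comp_assoc.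
      + intros R r s hR.
        apply (rep_ext (rep_eq hpb hprod (x' \o s) (q \o r))); intros; now rewrite !comp_assoc.
    - intros Y h; split; intros k Z z a; specialize (k Z z a);
        rewrite !comp_assoc in *; exact k. }
  assert (ij : forall Z (a : Z --> A) (b : Z --> B), i \o a = j \o b -> x \o a = y \o b).
  { intros Z a b h; destruct (gluing_meet _ _ _ _ G _ _ _ h) as (c & <- & <-).
    rewrite <- !comp_assoc; congruence. }
  assert (ii : forall Z (a a' : Z --> A), i \o a = i \o a' -> x \o a = x \o a').
  { intros Z a a' h.
    apply (covering_eq hpb hprod (gluing_ker _ _ _ _ G _ _ _ h)).
    intros T t [h'|(c & c' & h1 & h2 & h3)]; rewrite !comp_assoc; [congruence|].
    rewrite <- h1, <- h2, <- !comp_assoc, e, !comp_assoc; congruence. }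
  destruct (unique_choice hprod (phi := phi)) as (h & h1 & h2).
  - intros P p q hP; apply (rep_and hpb); apply rimp.
  - apply (covering_weaken (gluing_cover _ _ _ _ G)).
    intros T t [[a <-]|[b <-]]; [exists (x \o a)|exists (y \o b)];
      split; intros Z z u; rewrite !comp_assoc; intros hu.
    + now apply ii.
    + symmetry; apply ij; congruence.
    + now apply ij.
    + now rewrite (gluing_mono _ _ _ _ G _ _ _ hu).
  - intros T t v v' [h1 h2] [h3 h4].
    apply (covering_eq hpb hprod (covering_pull t (gluing_cover _ _ _ _ G))).
    intros V z [[a ha]|[b hb]].
    + rewrite <- (h1 V z a ha); now apply h3.
    + rewrite <- (h2 V z b hb); now apply h4.
  - exists h; split.
    + split; symmetry.
      * rewrite <- (h1 A i (idm A)); rewrite ?comp_id_r, ?comp_id_l; easy.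
      * rewrite <- (h2 B j (idm B)); rewrite ?comp_id_r, ?comp_id_l; easy.
    + intros k [k1 k2].
      apply (covering_eq hpb hprod (gluing_cover _ _ _ _ G)).
      intros T t hit; symmetry; destruct hit as [[a <-]|[b <-]]; rewrite <- (comp_assoc _ _ _ _ _ k).
      * rewrite k1; apply h1; now rewrite comp_id_l.
      * rewrite k2; apply h2; now rewrite comp_id_l.
Qed.

(** Let [phi] relate [a] and [b] coming from one [c], and let [rho] be the intended kernel relation
    of [i]. Send [a] to its [rho]-class and the set of its [phi]-relatives, and [b] to the set of
    its [phi]-relatives and its singleton; [D] is the joint image in [PA * PB]. *)
Lemma gluing_exists {A B C : E} (f : C --> A) (g : C --> B) :
  is_mono f -> exists (D : E) (i : A --> D) (j : B --> D), gluing f g i j.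
Proof.
  intros mf.
  destruct (power_object A) as (PA & memA & compA & extA).
  destruct (power_object B) as (PB & memB & compB & extB).
  set (phi := fun Y (a : Y --> A) (b : Y --> B) => exists c, f \o c = a /\ g \o c = b).
  assert (rphi : representable2 phi).
  { intros P p q hP.
    (* [C] itself is the relation: the pairing of [f] and [g] is mono because [f] is. *)
    destruct (product_pair hP f g) as (m & m1 & m2).
    exists C, m; split.
    - intros Y x y e; apply mf; rewrite <- m1, !comp_assoc; congruence.
    - intros Y h; split; intros [c hc]; exists c.
      + apply (product_ext hP); rewrite <- comp_assoc; destruct hc; congruence.
      + subst h; rewrite <- !comp_assoc; split; congruence. }
  set (rho := fun Y (a a' : Y --> A) =>
    covering (fun T (t : T --> Y) => a \o t = a' \o t \/
      exists c c', f \o c = a \o t /\ f \o c' = a' \o t /\ g \o c = g \o c')).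
  assert (rrho : representable2 rho).
  { intros P p q hP.
    (* [rho] is the union of the diagonal and the image under [f] of the kernel pair of [g]. *)
    destruct (hpb _ _ _ g g) as (K & k & k' & hK).
    destruct (product_pair hP (idm A) (idm A)) as (dl & dl1 & dl2).
    destruct (product_pair hP (f \o k) (f \o k')) as (kp & kp1 & kp2).
    apply (rep_ext (rep_joint_image dl kp)); intros Y h; split;
      intros c; apply (covering_weaken c); intros T t; rewrite !comp_assoc.
    - intros [[a ha]|[l hl]]; [left|right].
      + rewrite <- ha, <- !comp_assoc; congruence.
      + exists (k \o l), (k' \o l).
        rewrite <- hl, <- !comp_assoc, kp1, kp2, (proj1 hK); easy.
    - intros [e|(c0 & c1 & h1 & h2 & h3)]; [left|right].
      + exists (p \o (h \o t)); apply (product_ext hP);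
          rewrite <- (comp_assoc _ _ _ _ _ _ dl), ?dl1, ?dl2, comp_id_l; easy.
      + destruct (pullback_lift hK c0 c1 h3) as (l & <- & <-).
        exists l; apply (product_ext hP); rewrite <- (comp_assoc _ _ _ _ _ _ kp);
          rewrite ?kp1, ?kp2, comp_assoc; easy. }
  destruct (compA A (fun Y a a' => rho Y a a') rrho) as (SA & hSA).
  destruct (compB A phi rphi) as (TA & hTA).
  destruct (compA B (fun Y b a => phi Y a b)) as (SB & hSB).
  { intros P p q hP; apply (rphi P q p).
    intros X x y; destruct (hP X y x) as [h [[h1 h2] un]].
    exists h; split; [easy|]; intros l [l1 l2]; now apply un. }
  destruct (compB B (fun Y b b' => b = b')) as (TB & hTB).
  { intros P p q hP; apply (rep_eq hpb hprod). }
  destruct (hprod PA PB) as (Q & p & q & hQ).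
  destruct (product_pair hQ SA TA) as (al & al1 & al2).
  destruct (product_pair hQ SB TB) as (be & be1 & be2).
  destruct (rep_joint_image al be) as (D & n & mn & hn).
  assert (hi : factors n al).
  { apply hn, covering_all; intros T t; left; now exists t. }
  assert (hj : factors n be).
  { apply hn, covering_all; intros T t; right; now exists t. }
  destruct hi as [i hi], hj as [j hj].
  assert (reflA : forall Y (a : Y --> A), rho Y a a).
  { intros Y a; apply covering_all; intros; now left. }
  assert (projA : forall Y (a : Y --> A), SA \o a = p \o (n \o (i \o a)) /\ TA \o a = q \o (n \o (i \o a))).
  { intros Y a; rewrite <- (comp_assoc _ _ _ _ _ n), hi, <- !comp_assoc, al1, al2; easy. }
  assert (projB : forall Y (b : Y --> B), SB \o b = p \o (n \o (j \o b)) /\ TB \o b = q \o (n \o (j \o b))).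
  { intros Y b; rewrite <- (comp_assoc _ _ _ _ _ n), hj, <- !comp_assoc, be1, be2; easy. }
  exists D, i, j; split.
  - apply mn; rewrite <- !comp_assoc, hi, hj.
    apply (product_ext hQ); rewrite <- !comp_assoc.
    + rewrite al1, be1; apply extA; intros Y c a.
      rewrite !comp_assoc, hSA, hSB; split.
      * intros cov.
        (* Being related to [g \o c] is representable, so the local alternatives in [rho] can be
           eliminated into it; [f] mono settles the second one. *)
        assert (r : representable (fun T (t : T --> Y) => phi T (a \o t) (g \o c \o t))).
        { destruct (hprod A B) as (R & r & s & hR).
          destruct (product_pair hR a (g \o c)) as (k & k1 & k2).
          apply (rep_ext (rep_subst hpb k (rphi R r s hR))).
          intros T t; rewrite <- !comp_assoc, k1, k2; easy. }
        rewrite <- (comp_id_r _ _ _ a), <- (comp_id_r _ _ _ (g \o c)).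
        apply (covering_elim cov r).
        intros T t; rewrite !comp_assoc.
        intros [<-|(c0 & c1 & h1 & h2 & h3)].
        -- exists (c \o t); easy.
        -- apply mf in h1; subst c0; now exists c1.
      * intros (c' & <- & h).
        apply covering_all; intros T t; right.
        exists (c \o t), (c' \o t); rewrite !comp_assoc; repeat split.
        rewrite <- !comp_assoc; congruence.
    + rewrite al2, be2; apply extB; intros Y c b.
      rewrite !comp_assoc, hTA, hTB; split.
      * intros (c' & h1 & <-); apply mf in h1; now subst c'.
      * intros <-; now exists c.
  (* Here and in the next two conditions, an evident membership (in a singleton or in the element's
     own [rho]-class) is transported along the equality of fibres. *)
  - intros Y b b' e.
    apply hTB.
    rewrite (proj2 (projB Y b)), e, <- (proj2 (projB Y b')); now apply hTB.
  - intros Y a b e.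
    apply hTA.
    rewrite (proj2 (projA Y a)), e, <- (proj2 (projB Y b)); now apply hTB.
  - intros Y a a' e.
    apply hSA.
    rewrite (proj1 (projA Y a)), e, <- (proj1 (projA Y a')); apply hSA, reflA.
  (* Since [n] factors through itself, the defining predicate of the joint image holds of [n]. *)
  - assert (cov : factors n n) by (exists (idm D); apply comp_id_r).
    apply hn in cov; apply (covering_weaken cov).
    intros T t [[a h]|[b h]]; [left; exists a|right; exists b];
      apply mn; rewrite <- comp_assoc; congruence.
Qed.

(** The constructed gluing square is itself a pushout of the span, so its conditions transfer to the
    given one. *)
Lemma gluing_of_pushout {A B C D : E}
    {f : C --> A} {g : C --> B} {i : A --> D} {j : B --> D} :
  is_mono f -> is_pushout f g i j -> gluing f g i j.
Proof.
  intros mf po; destruct (gluing_exists f g mf) as (D0 & i0 & j0 & G).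
  exact (gluing_of_pushouts (pushout_of_gluing G) po G).
Qed.

End Topos.

(** * Adhesivity; reflecting the cube reduces the case of [g] mono to that of [f] mono *)

Lemma cube_sym {E : category} {A B C D A' B' C' D' : E}
    {f : C --> A} {g : C --> B} {i : A --> D} {j : B --> D}
    {f' : C' --> A'} {g' : C' --> B'} {i' : A' --> D'} {j' : B' --> D'}
    {a : A' --> A} {b : B' --> B} {c : C' --> C} {d : D' --> D} :
  commutative_cube f g i j f' g' i' j' a b c d ->
  commutative_cube g f j i g' f' j' i' b a c d.
Proof. intros []; now split. Qed.

Theorem theorem3p1 (E : category) (hE : is_topos E) : is_adhesive E.
Proof.
  split.
  - exact (hpb hE).
  - intros A B C f g [mf|mg].
    + destruct (gluing_exists hE f g mf) as (D & i & j & G).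
      exists D, i, j; exact (pushout_of_gluing hE G).
    + destruct (gluing_exists hE g f mg) as (D & i & j & G).
      exists D, j, i; exact (pushout_sym (pushout_of_gluing hE G)).
  - intros A B C D A' B' C' D' f g i j f' g' i' j' a b c d cube [po [mf|mg]] hA hB hC.
    + exact (pushout_of_gluing hE
        (gluing_pullback cube (gluing_of_pushout hE mf po) hA hB hC)).
    + apply pushout_sym, (pushout_of_gluing hE).
      apply (gluing_pullback (cube_sym cube) (gluing_of_pushout hE mg (pushout_sym po)) hB hA).
      (* The pullback over [C] is stated through [A]; commutativity of both faces restates it
         through [B]. *)
      now rewrite <- (cube_bottom _ _ _ _ _ _ _ _ _ _ _ _ cube),
        <- (cube_top _ _ _ _ _ _ _ _ _ _ _ _ cube).
  - intros A B C D A' B' C' D' f g i j f' g' i' j' a b c d cube [po [mf|mg]] [po' _] hA hB.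
    (* [f'] is mono as a pullback of [f], so the top face is a gluing square with the same
       orientation as the bottom one. *)
    + exact (gluing_cube (hpb hE) (hprod hE) cube mf (gluing_of_pushout hE mf po)
        (gluing_of_pushout hE (mono_pullback hA mf) po') hA hB).
    + apply and_comm.
      exact (gluing_cube (hpb hE) (hprod hE) (cube_sym cube) mg
        (gluing_of_pushout hE mg (pushout_sym po))
        (gluing_of_pushout hE (mono_pullback hB mg) (pushout_sym po')) hB hA).
Qed.
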